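(* Let $n\ge 1$, $c\ge 0$ and $k$ be integers with $0\le k\le c$. The generating function, with respect to the norm, of strict plane partitions with parts in $\{1,2,\dots,n\}$, at most $c$ columns and exactly $k$ parts equal to $n$ is $$ \sum_{\pi} q^{n(\pi)} = \frac{q^{kn}\,[k+1;q]_{n-1}\,[1+c-k;q]_{n-1}}{[1;q]_{n-1}}\prod_{i=1}^{n-1}\frac{[c+i+1;q]_{i-1}}{[i;q]_i}, $$ where the sum is over all such strict plane partitions $\pi$.
   Context: A strict plane partition of shape $\lambda=(\lambda_1\ge\lambda_2\ge\dots\ge\lambda_r)$ (a partition) is an array $(\pi_{i,j})_{1\le i\le r,\,1\le j\le\lambda_i}$ of non-negative integers whose rows are weakly decreasing (from left to right) and whose columns are strictly decreasing (from top to bottom). Its norm $n(\pi)$ is the sum of its parts (entries). Here all parts lie in $\{1,\dots,n\}$; shapes are partitions with positive parts, and the empty partition (empty array) is allowed. ''At most $c$ columns'' means $\lambda_1\le c$. $q$ is an indeterminate, $[m;q]=\frac{1-q^m}{1-q}$ (so $[m;q]=1+q+\dots+q^{m-1}$ for $m\ge1$), and $[a;q]_m=\prod_{i=0}^{m-1}[a+i;q]$ for $m\ge 0$ (empty product equal to $1$). *)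

(* Defs.v *)
From HB Require Import structures.
From mathcomp Require Import all_boot all_order all_algebra fraction.

Set Implicit Arguments.
Unset Strict Implicit.
Unset Printing Implicit Defensive.

Import GRing.Theory.

(* An array of shape [lambda] is the list of its rows: row [i] (counted from 0)
   has length [lambda_(i+1)].  As [lambda] has positive parts, there is no
   empty row, and the empty array is [[::]]. *)
Notation array := (seq (seq nat)).

Definition is_partition (la : seq nat) : bool :=
  sorted geq la && (0 \notin la).

Definition column (pi : array) (j : nat) : seq nat :=
  [seq nth 0 row j | row <- pi & j < size row].

Definition ncolumns (pi : array) : nat := head 0 (shape pi).

Definition strict_plane_partition (pi : array) : bool :=
  [&& is_partition (shape pi),
      all (sorted geq) pi &
      all (fun j => sorted gtn (column pi j)) (iota 0 (ncolumns pi))].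

Definition norm (pi : array) : nat := sumn (flatten pi).

Definition is_spp (n c k : nat) (pi : array) : bool :=
  [&& strict_plane_partition pi,
      all (fun x => 1 <= x <= n) (flatten pi),
      ncolumns pi <= c &
      count_mem n (flatten pi) == k].

Record spp (n c k : nat) : Type :=
  Spp { spp_array :> array; _ : is_spp n c k spp_array }.

HB.instance Definition _ n c k := [isSub for @spp_array n c k].
HB.instance Definition _ n c k := [Countable of spp n c k by <:].

Section Finiteness.

Fixpoint words (T : Type) (a : seq T) (m : nat) : seq (seq T) :=
  if m is m'.+1 then [::] :: [seq x :: s | x <- a, s <- words a m']
  else [:: [::]].

Lemma mem_words (T : eqType) (a : seq T) m s :
  size s <= m -> all [in a] s -> s \in words a m.
Proof.
elim: m s => [|m IHm] [|x s] //= le_s /andP[ax a_s].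
by rewrite in_cons; apply/orP; right; apply: allpairs_f => //; apply: IHm.
Qed.

Lemma sorted_gtn_size n s :
  sorted gtn s -> all (fun x => 1 <= x <= n) s -> size s <= n.
Proof.
move=> s_dec /allP s_bnd; rewrite -[n in _ <= n](size_iota 1).
apply: uniq_leq_size => [|x /s_bnd]; last by rewrite mem_iota add1n ltnS.
apply: (sorted_uniq _ _ s_dec) => [y x z /= ? /ltn_trans|x /=].
  exact.
exact: ltnn.
Qed.

Lemma column0 (pi : array) : 0 \notin shape pi ->
  column pi 0 = [seq head 0 row | row <- pi].
Proof.
rewrite /column; elim: pi => //= -[|x row] pi IHpi //=.
by rewrite in_cons /= => /IHpi ->.
Qed.

Lemma is_spp_size n c k pi : is_spp n c k pi -> size pi <= n.
Proof.
case/and4P=> /and3P[/andP[_ pos] _ cols] bnd _ _.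
rewrite -(size_map (head 0)) -column0 //; apply: sorted_gtn_size.
  case: pi pos cols {bnd} => //= -[|x row] pi //= _.
  by case/andP.
apply/allP => x; rewrite column0 // => /mapP[row row_pi ->].
apply: (allP bnd); apply/flattenP; exists row => //.
case: row row_pi => [|y row] row_pi; last exact: mem_head.
by case/negP: pos; apply/mapP; exists [::].
Qed.

Lemma is_spp_row_size n c k pi row :
  is_spp n c k pi -> row \in pi -> size row <= c.
Proof.
case/and4P=> /and3P[/andP[dec _] _ _] _ le_c _ row_pi.
apply: leq_trans le_c; have : size row \in shape pi by apply: map_f.
rewrite /ncolumns; case: (shape pi) dec => //= m la.
rewrite (path_sortedE (rev_trans leq_trans)) => /andP[/allP ge_m _].
by rewrite in_cons => /predU1P[->|/ge_m].
Qed.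

Definition spp_enum n c k : seq (spp n c k) :=
  undup (pmap insub (words (words (iota 1 n) c) n)).

Lemma spp_enumP n c k : Finite.axiom (spp_enum n c k).
Proof.
apply: Finite.uniq_enumP => [|pi]; first exact: undup_uniq.
rewrite mem_undup mem_pmap_sub; case: pi => pi pi_spp /=.
apply: mem_words; first exact: is_spp_size pi_spp.
apply/allP => row row_pi; apply: mem_words.
  exact: is_spp_row_size pi_spp row_pi.
have /and4P[_ /allP bnd _ _] := pi_spp.
apply/allP => x x_row; rewrite /= mem_iota add1n ltnS; apply: bnd.
by apply/flattenP; exists row.
Qed.

End Finiteness.

HB.instance Definition _ n c k := isFinite.Build (spp n c k) (@spp_enumP n c k).

Local Open Scope ring_scope.

Definition qint (F : fieldType) (q : F) (m : nat) : F := (1 - q ^+ m) / (1 - q).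

Definition qrising (F : fieldType) (q : F) (a m : nat) : F :=
  \prod_(0 <= i < m) qint q (a + i).

Notation ratfun := {fraction {poly rat}}.

Definition qvar : ratfun := tofrac 'X.

(* Main.v *)
Require Import Defs.
From mathcomp Require Import all_boot all_order all_algebra fraction.
From mathcomp Require Import zify ring.
Set Implicit Arguments.
Unset Strict Implicit.
Unset Printing Implicit Defensive.
Import GRing.Theory.
Local Open Scope ring_scope.

(** Fix [n = m + 1].  Give a part [v <= m] the weight [q ^ v] and a part equal
    to [n] the weight [X]: the arrays with parts in [1 .. n] and at most [c]
    columns then have a generating polynomial [G(X)], and up to the factor
    [q ^ (k * n)] the theorem asks for its coefficient at [X ^ k].

    Removing the parts equal to 1 shrinks the shape by a horizontal strip, so
    arrays are chains of interlacing shapes.  Encode a shape by the strictly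
    increasing list of its [n] numbers (row length + row index), all smaller
    than [N = c + n].  In these coordinates adding a variable [w] to a chain is
    the substitution of a geometric series in each coordinate, and for an
    alternating test function the interlacing inequalities come for free:
    every list that violates them cancels with the list in which two entries
    are exchanged ([sum_interlace]).  Induction on the number of variables gives
    the bialternant formula for Schur functions, in a form summed against an
    alternating test function [phi] ([bialternant]):
      Vandermonde(x) * sum over arrays of (weight * phi(shape))
        = sum over all t in [0, N)^n of phi(t) * x_1 ^ t_1 * .. * x_n ^ t_n.

    Take for [phi] the sign of the permutation that sorts [t]; it is 1 on
    shapes.  The coefficient [a_k] of [X ^ k] on the right is, up to sign, the
    sum over [t] of the sign of the list [k :: t] times the monomial of [t] in
    the other variables.  When [k] increases by one, the sign changes only if
    some entry of [t] is crossed, so that [a_k] is, for [0 <= k < N], a linear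
    combination of [1] and of the [x_i ^ k] with [i < n]
    ([alternant_exponential]).  Here [x_i = q ^ i], so [a_k] is a polynomial in
    [q ^ k] of degree at most [m].

    Up to a scalar, [sum_k a_k X ^ k] is [G(X)] times the product of the
    [X - q ^ i], [1 <= i <= m].  Removing these [m] factors one at a time
    raises the degree of the polynomial in [q ^ k] by one each time, and
    extends its range of validity by one index to the left ([strip_factors]).
    Hence [q ^ (m * k)] times the coefficient [g_k] of [G] is a polynomial in
    [q ^ k] of degree at most [2m], for [- m <= k <= c + m].  It vanishes at
    the [2m] indices of this range outside [0 .. c], which determines [g_k] up
    to a factor independent of [k]:
      g_k = C_m * [k + 1; q]_m * [c - k + 1; q]_m  ([refined_poly_coef]).

    Finally an array with parts in [1 .. n + 1] and no part [n + 1] is an array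
    with parts in [1 .. n], so that [C_(m+1)] is given by [C_m] and the sum of
    all [q ^ (k * n) * g_k], which is a q-Vandermonde convolution
    ([qbinom_convolution]). *)

(** * Sums of alternating functions over all lists *)

Section Alternating.
Variable R : idomainType.
Implicit Types (phi : seq nat -> R) (f g : nat -> R) (fs : seq (nat -> R)).

Definition alternating phi :=
  forall s a b u, phi (s ++ a :: b :: u) = - phi (s ++ b :: a :: u).

Lemma alternating_cons phi t :
  alternating phi -> alternating (fun s => phi (t :: s)).
Proof. by move=> alt s a b u; apply: (alt (t :: s)). Qed.

Variable N : nat.

(** For an alternating [phi] this is the value of [phi] on the exterior product
    of the vectors [fs] of dimension [N]; the recursion on [fs] lets every
    multilinear identity be proved one coordinate at a time. *)
Fixpoint nsum fs phi : R :=
  if fs is f :: fs' then \sum_(t < N) f t * nsum fs' (fun s => phi (val t :: s))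
  else phi [::].

Lemma eq_nsum fs phi psi : phi =1 psi -> nsum fs phi = nsum fs psi.
Proof.
elim: fs phi psi => [|f fs IH] phi psi e /=; first exact: e.
by apply: eq_bigr => t _; congr (_ * _); apply: IH => s; apply: e.
Qed.

Lemma nsum_lin (I : finType) fs (c : I -> R) (phi : I -> seq nat -> R) :
  nsum fs (fun s => \sum_i c i * phi i s) = \sum_i c i * nsum fs (phi i).
Proof.
elim: fs phi => //= f fs IH phi.
under eq_bigr => t _ do rewrite IH big_distrr /=.
rewrite exchange_big; apply: eq_bigr => i _; rewrite big_distrr /=.
by apply: eq_bigr => t _; rewrite mulrCA.
Qed.

Lemma nsumZ fs c phi : nsum fs (fun s => c * phi s) = c * nsum fs phi.
Proof.
elim: fs phi => //= f fs IH phi; rewrite big_distrr /=.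
by apply: eq_bigr => t _; rewrite IH mulrCA.
Qed.

Lemma nsumN fs phi : nsum fs (fun s => - phi s) = - nsum fs phi.
Proof.
by rewrite -mulN1r -nsumZ; apply: eq_nsum => s; rewrite mulN1r.
Qed.

Lemma nsumD fs phi psi :
  nsum fs (fun s => phi s + psi s) = nsum fs phi + nsum fs psi.
Proof.
elim: fs phi psi => //= f fs IH phi psi; rewrite -big_split.
by apply: eq_bigr => t _; rewrite /= IH mulrDr.
Qed.

Lemma nsum_swap f g fs phi : alternating phi ->
  nsum (f :: g :: fs) phi = - nsum (g :: f :: fs) phi.
Proof.
move=> alt /=.
under eq_bigr => t _ do rewrite big_distrr /=.
rewrite exchange_big -sumrN; apply: eq_bigr => u _ /=.
rewrite big_distrr -sumrN; apply: eq_bigr => t _ /=.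
rewrite (eq_nsum _ (fun s => alt [::] t u s)) nsumN /=; ring.
Qed.

Hypothesis two_neq0 : 2%:R != 0 :> R.

Lemma nsum_dup f fs phi : alternating phi -> nsum (f :: f :: fs) phi = 0.
Proof.
move=> /(nsum_swap f f fs) /eqP; rewrite -addr_eq0 -mulr2n -mulr_natr mulf_eq0.
by rewrite (negbTE two_neq0) orbF => /eqP.
Qed.

(** Column operations: the terms in which a second coordinate carries [g]
    vanish.  The alternation concerns neighbours only, so [g] is moved along
    the list by exchanges. *)
Lemma nsum_shear g fs phi : alternating phi ->
  nsum (g :: [seq (fun t => f t - g t) | f <- fs]) phi = nsum (g :: fs) phi.
Proof.
elim: fs phi => // f fs IH phi alt.
rewrite map_cons [LHS]nsum_swap // [RHS]nsum_swap //; congr (- _).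
transitivity (nsum ((fun t => f t - g t) :: g :: fs) phi).
  by apply: eq_bigr => t _; congr (_ * _); exact: (IH _ (alternating_cons t alt)).
rewrite -[RHS]subr0 -(nsum_dup g fs alt) /= -sumrB.
by apply: eq_bigr => t _; rewrite mulrBl.
Qed.

Lemma nsum_rcons f fs phi : alternating phi ->
  nsum (rcons fs f) phi = (-1) ^+ size fs * nsum (f :: fs) phi.
Proof.
elim: fs phi => [|g fs IH] phi alt; first by rewrite mul1r.
rewrite (nsum_swap f g fs alt) exprS mulN1r mulrNN rcons_cons.
rewrite [LHS]/= [in RHS]/nsum -/nsum big_distrr; apply: eq_bigr => t _.
by rewrite (IH _ (alternating_cons _ alt)) mulrCA.
Qed.

End Alternating.

(** * Interlacing lists *)

Section Interlacing.

Fixpoint interlace N a (p : seq nat) : seq (seq nat) :=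
  if p is b :: p' then
    [seq t :: s | t <- index_iota a b.+1, s <- interlace N b.+1 p']
  else [seq [:: t] | t <- index_iota a N].

(** For a shape [l] grown from [a], the number of added cells. *)
Fixpoint gaps (a l : seq nat) : nat :=
  if (a, l) is (x :: a', t :: l') then t - x + gaps a' l' else 0.

Variable R : idomainType.
Hypothesis two_neq0 : 2%:R != 0 :> R.
Variable w : R.

(** The weight [w ^ (t - a)] of the cells added to a row whose coordinate grows
    from [a] to [t]. *)
Definition geom a t : R := if (a <= t)%N then w ^+ (t - a) else 0.

Lemma sum_geom N a (F : nat -> R) :
  \sum_(t < N) geom a t * F t = \sum_(a <= t < N) w ^+ (t - a) * F t.
Proof.
rewrite -(big_mkord xpredT (fun t => geom a t * F t)).
rewrite [RHS](big_nat_widenl _ 0) // [RHS]big_mkcond /=.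
by apply: eq_bigr => t _; rewrite /geom; case: ifP => _; rewrite ?mul0r.
Qed.

(** The lists on the right only satisfy the lower bounds of interlacing.  Where
    an upper bound fails first, so that the entry [t] exceeds [b], both [t] and
    the next entry range over all values above [b], with the same weight up to
    a constant: exchanging them shows that these terms cancel. *)
Lemma sum_interlace N a p phi : alternating phi ->
  path ltn a (map succn p) -> all (ltn^~ N) p ->
  \sum_(l <- interlace N a p) w ^+ gaps (a :: map succn p) l * phi l =
  nsum N (map geom (a :: map succn p)) phi.
Proof.
elim: p a phi => [|b p IH] a phi alt.
  move=> _ _; rewrite /= (sum_geom N a (fun t => phi [:: t])) big_map.
  by apply: eq_bigr => t _; rewrite addn0.
move=> /= /andP[ab bp] /andP[bN pN].
pose F t := nsum N (geom b.+1 :: map geom (map succn p)) (fun s => phi (t :: s)).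
rewrite big_allpairs_dep /= (sum_geom N a F) [RHS](big_cat_nat (n := b.+1)) /=; try lia.
rewrite [X in _ + X](_ : _ = 0) ?addr0.
  apply: eq_bigr => t _; have := IH b.+1 _ (alternating_cons t alt) bp pN.
  by rewrite /F /= => <-; rewrite big_distrr; apply: eq_bigr => l _; rewrite /= exprD mulrA.
(* The terms with [t > b] form a sum in which the vector [geom b.+1] is
   repeated, up to a power of [w]. *)
have := nsum_dup N two_neq0 (geom b.+1) (map geom (map succn p)) alt.
rewrite /= (sum_geom N b.+1 F) => e0.
rewrite -[RHS](mulr0 (w ^+ (b.+1 - a))) -[X in _ = _ * X]e0.
rewrite big_distrr /= [LHS]big_nat [RHS]big_nat.
apply: eq_bigr => t /andP[bt tN]; rewrite mulrA -exprD; congr (_ ^+ _ * _).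
by lia.
Qed.

(** Summed against powers of an older variable [x], the geometric weight is a
    divided difference of powers; this produces the factors of the Vandermonde
    product. *)
Lemma geom_power M x (t : 'I_M.+1) :
  (x - w) * (\sum_(p < M) x ^+ p * geom p.+1 t) = x ^+ t - w ^+ t.
Proof.
rewrite -opprB -[RHS]opprB subrXX mulNr; congr (- (_ * _)).
rewrite -(big_mkord xpredT (fun p => x ^+ p * geom p.+1 t)).
rewrite (big_cat_nat (n := t)) //=; last by have := ltn_ord t; lia.
rewrite [X in _ + X]big_nat_cond [X in _ + X]big1 ?addr0 => [|p]; last first.
  by rewrite andbT => /andP[tp _]; rewrite /geom ltnNge tp mulr0.
rewrite big_mkord; apply: eq_bigr => p _.
by rewrite /geom ltn_ord mulrC subnS -predn_sub.
Qed.

Definition power (x : R) (t : nat) : R := x ^+ t.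

Lemma nsum_geom M xs phi :
  (\prod_(x <- xs) (x - w)) *
    nsum M (map power xs) (fun p => nsum M.+1 (map (geom \o succn) p) phi) =
  nsum M.+1 (map (fun x t => power x t - power w t) xs) phi.
Proof.
elim: xs phi => [|x xs IH] phi; first by rewrite big_nil mul1r.
rewrite big_cons /=.
pose psi (t : 'I_M.+1) s :=
  nsum M.+1 (map (geom \o succn) s) (fun u => phi (val t :: u)).
under [X in _ * X = _]eq_bigr => p _ do
  rewrite (nsum_lin _ _ (fun t : 'I_M.+1 => geom p.+1 t) psi) big_distrr /=.
rewrite exchange_big big_distrr; apply: eq_bigr => t _ /=.
under [X in _ * X = _]eq_bigr => p _ do rewrite mulrA.
by rewrite -big_distrl /= mulrACA IH geom_power.
Qed.

End Interlacing.

(** * Arrays as chains of interlacing shapes *)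
Section Patterns.
Local Open Scope nat_scope.

(** The inverse of [peel], given the number [k] of parts 1 that [peel] removed. *)
Definition grow (r : seq nat) k := map succn r ++ nseq k 1.
Definition peel (r : seq nat) := [seq v.-1 | v <- r & (1 < v)].

(** Here and below an array is listed from the bottom row to the top row and
    padded with empty rows, so that an array with parts in [1 .. n] has exactly
    [n] rows.  Adding the row index to the row length turns the weakly
    increasing row lengths into a strictly increasing list. *)
Fixpoint coords i (P : seq (seq nat)) : seq nat :=
  if P is r :: P' then (size r + i) :: coords i.+1 P' else [::].

Fixpoint extend i (P : seq (seq nat)) (l : seq nat) : seq (seq nat) :=
  if (P, l) is (r :: P', t :: l') then
    grow r (t - (size r + i)) :: extend i.+1 P' l'
  else [::].

(** A new empty row is put below [P] before its rows grow, and the interlacing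
    bounds are exactly what keeps the columns strict. *)
Fixpoint patterns c n : seq (seq (seq nat)) :=
  if n is n'.+1 then
    [seq extend 0 ([::] :: P) l
       | P <- patterns c n', l <- interlace (c + n'.+1) 0 (coords 0 P)]
  else [:: [::]].

Lemma patternsS c n :
  patterns c n.+1 =
  [seq extend 0 ([::] :: P) l
     | P <- patterns c n, l <- interlace (c + n).+1 0 (coords 0 P)].
Proof. by rewrite -addnS. Qed.

Definition is_row n r := sorted geq r && all (fun v => 0 < v <= n) r.

Definition row_below r s :=
  (size r <= size s) && all (fun j => nth 0 r j < nth 0 s j) (iota 0 (size r)).

Definition is_pattern c n P :=
  [&& size P == n, all (is_row n) P, sorted row_below P
    & (size (last [::] P) <= c)].

Lemma row_belowP r s :
  reflect ((size r <= size s) /\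
           forall j, (j < size r) -> (nth 0 r j < nth 0 s j))
          (row_below r s).
Proof.
apply: (iffP andP) => -[le_rs H]; split=> //.
  by move=> j jr; apply: (allP H); rewrite mem_iota.
by apply/allP => j; rewrite mem_iota; apply: H.
Qed.

Lemma size_coords i P : size (coords i P) = size P.
Proof. by elim: P i => //= r P IH i; rewrite IH. Qed.

Lemma coordsS i P : coords i.+1 P = map succn (coords i P).
Proof. by elim: P i => //= r P IH i; rewrite IH addnS. Qed.

Lemma size_grow r k : size (grow r k) = (size r + k).
Proof. by rewrite size_cat size_map size_nseq. Qed.

Lemma nth_grow r k j : (j < size r + k) -> nth 0 (grow r k) j = (nth 0 r j).+1.
Proof.
move=> jrk; rewrite nth_cat size_map; case: ltnP => jr; first by rewrite (nth_map 0).
by rewrite nth_nseq (nth_default 0 jr) ifT //; lia.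
Qed.

Lemma is_row_grow n r k : is_row n r -> is_row n.+1 (grow r k).
Proof.
case/andP=> r_dec /allP r_bnd; apply/andP; split; last first.
  rewrite all_cat all_map all_nseq orbT andbT.
  by apply/allP => v /r_bnd /=; lia.
rewrite (sorted_pairwise (rev_trans leq_trans)) pairwise_cat.
rewrite -!(sorted_pairwise (rev_trans leq_trans)) sorted_map r_dec /=.
apply/andP; split.
  by apply/allrelP => u v /mapP[x _ ->] /nseqP[-> _].
by case: k => //= k; elim: k.
Qed.

Lemma peel_grow n r k : is_row n r -> peel (grow r k) = r.
Proof.
case/andP=> _ r_bnd; rewrite /peel filter_cat map_cat.
rewrite [X in _ ++ X](_ : _ = [::]) ?cats0; last by elim: k.
by elim: r r_bnd => //= v r IH /andP[/andP[v0 _] /IH]; rewrite ltnS v0 /= => ->.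
Qed.

Lemma grow_peel n r : is_row n r -> grow (peel r) (size r - size (peel r)) = r.
Proof.
rewrite /grow; case/andP; elim: r => //= v r IH r_dec /andP[/andP[v0 _] r_bnd].
move: (IH (path_sorted r_dec) r_bnd); case: (ltnP 1 v) => v1 e.
  by rewrite /peel /= v1 /= prednK // subSS e.
rewrite /peel; have -> : v = 1 by lia.
rewrite /=.
have r1 x : x \in r -> x = 1.
  rewrite (path_sortedE (rev_trans leq_trans)) in r_dec.
  have /andP[/allP ge_v _] := r_dec.
  by move=> xr; have := ge_v _ xr; have := allP r_bnd _ xr; move=> /=; lia.
have -> : [seq i <- r | (1 < i)] = [::].
  by apply/eqP; rewrite -[_ == _]negbK -has_filter -all_predC; apply/allP => x /r1 ->.
by rewrite subn0 /=; congr (_ :: _); apply/esym/all_pred1P/allP => x /r1 ->.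
Qed.

Lemma is_row_peel n r : is_row n.+1 r -> is_row n (peel r).
Proof.
case/andP=> r_dec r_bnd; apply/andP; split; last first.
  rewrite all_map; apply/allP => v; rewrite mem_filter => /andP[v1 vr].
  by have := allP r_bnd _ vr => /=; lia.
rewrite sorted_map.
apply: (@sub_sorted _ geq) => [x y /=|]; first lia.
by apply: sorted_filter r_dec; apply: rev_trans leq_trans.
Qed.

(** Each new 1 must lie below a part greater than 1, that is, below an old cell
    of the next row: the grown row may not be longer than the old row above. *)
Lemma row_below_grow n r k s k' : is_row n s ->
  row_below (grow r k) (grow s k') = (size r + k <= size s) && row_below r s.
Proof.
case/andP=> _ s_bnd; have s_pos j : (nth 0 s j > 0) = (j < size s).
  by case: (ltnP j (size s)) => js; [have := all_nthP 0 s_bnd j js; case/andP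
                                    | rewrite nth_default].
apply/row_belowP/andP; rewrite !size_grow.
  case=> le_rs lt_rs.
  have le : (size r + k <= size s).
    case: (posnP (size r + k)) => [->//|rk0].
    have := lt_rs (size r + k).-1; rewrite prednK // leqnn => /(_ isT).
    rewrite !nth_grow ?prednK //.
    rewrite ltnS => H; have: (0 < nth 0 s (size r + k).-1) by exact: leq_ltn_trans H.
    by rewrite s_pos; lia.
  split=> //; apply/row_belowP; split=> [|j jr]; first by lia.
  by have := lt_rs j; rewrite !nth_grow ?ltnS; try lia; apply; lia.
case=> le /row_belowP[_ lt_rs]; split=> [|j jr]; first by lia.
rewrite !nth_grow //; last by lia.
rewrite ltnS; case: (ltnP j (size r)) => [/lt_rs //|j_r].
by rewrite nth_default // s_pos; lia.
Qed.

Lemma mem_interlace_cons N a b p t s :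
  (t :: s \in interlace N a (b :: p)) =
  (a <= t <= b) && (s \in interlace N b.+1 p).
Proof.
apply/allpairsPdep/andP => [[t' [s' [+ + [-> ->]]]]|[tab sp]].
  by rewrite mem_index_iota ltnS.
by exists t, s; rewrite mem_index_iota ltnS.
Qed.

Lemma mem_interlace1 N a t s :
  (t :: s \in interlace N a [::]) = (a <= t < N) && (s == [::]).
Proof.
apply/mapP/andP => [[t' + [-> ->]]|[tN /eqP->]]; first by rewrite mem_index_iota.
by exists t; rewrite ?mem_index_iota.
Qed.

Lemma nil_interlace N a p : ([::] \in interlace N a p) = false.
Proof.
by apply/negbTE/negP; case: p => [|b p] /=; [case/mapP|case/allpairsPdep=> ? [? []]].
Qed.

(** Growing along an interlacing list keeps the array strict, and both the old
    array and the list can be read off the result.  The first row is singled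
    out, with its index [i], since the bottom row starts empty. *)
Lemma extend_pattern N n i r P l :
  all (is_row n) (r :: P) -> sorted row_below (r :: P) ->
  l \in interlace N (size r + i) (coords i P) ->
  let B := extend i (r :: P) l in
  [/\ size B = (size P).+1, map peel B = r :: P & coords i B = l] /\
  [/\ all (is_row n.+1) B, sorted row_below B &
      (size (last [::] B) + i + size P < N)].
Proof.
elim: P i r l => [|s P IH] i r [|t l]; rewrite ?nil_interlace //.
  move=> /= /andP[r_row _] _; rewrite mem_interlace1 => /andP[tN /eqP->] /=.
  by rewrite is_row_grow // (peel_grow _ r_row) size_grow; split; split=> //; [congr [:: _]|]; lia.
move=> /= /andP[r_row Prow] /andP[rs sP]; rewrite mem_interlace_cons -addnS.
case/andP=> tb /(IH i.+1 s l Prow sP) /=.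
case: l => [|u l] /=; first by case=> [[]].
case=> [[szB pB cB] [rowB sortB lastB]]; split; split=> //.
- by rewrite szB.
- by rewrite (peel_grow _ r_row) pB.
- by rewrite size_grow cB; congr (_ :: _); lia.
- by rewrite is_row_grow.
- rewrite (row_below_grow _ _ _ (proj1 (andP Prow))) rs andbT sortB andbT.
  by lia.
- by move: lastB; lia.
Qed.

(** Conversely, an array is recovered from its peeled rows and its coordinates,
    which interlace. *)
Lemma peel_pattern N n i b B :
  all (is_row n.+1) (b :: B) -> sorted row_below (b :: B) ->
  (size (last b B) + i + size B < N) ->
  [/\ coords i (b :: B) \in interlace N (size (peel b) + i) (coords i (map peel B)),
      extend i (map peel (b :: B)) (coords i (b :: B)) = b :: B,
      all (is_row n) (map peel (b :: B)) & sorted row_below (map peel (b :: B))].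
Proof.
elim: B i b => [|s B IH] i b.
  move=> /= /andP[b_row _] _ bN; rewrite mem_interlace1 eqxx andbT.
  have sz : (size (peel b) <= size b).
    by rewrite -{2}(grow_peel b_row) size_grow leq_addr.
  by rewrite subnDr (grow_peel b_row) is_row_peel //; split=> //; lia.
move=> /= /andP[b_row Brow] /andP[bs sB] lastB.
have [] := IH i.+1 s Brow sB; first by move: lastB => /=; lia.
move=> /= cB eB rowB sortB.
have s_row := proj1 (andP Brow).
rewrite mem_interlace_cons -addnS cB eB.
have sz : (size (peel b) <= size b).
  by rewrite -{2}(grow_peel b_row) size_grow leq_addr.
move: bs; rewrite -{1}(grow_peel b_row) -{1}(grow_peel s_row).
rewrite (row_below_grow _ _ _ (is_row_peel s_row)) subnKC // => /andP[le bs].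
by rewrite subnDr (grow_peel b_row) is_row_peel //= bs sortB; split=> //; lia.
Qed.

(** First entries increase strictly from row to row, which bounds the number of
    nonempty rows by the largest part. *)
Lemma row_below_height r P : sorted row_below (r :: P) -> r != [::] ->
  (head 0 r + size P <= head 0 (last r P)).
Proof.
elim: P r => [|s P IH] r /=; first by rewrite addn0.
case/andP=> /row_belowP[le_rs lt_rs] sP r0.
have szr : (0 < size r) by case: r r0 {le_rs lt_rs}.
have := lt_rs 0 szr; rewrite !nth0.
have s0 : s != [::] by case: s le_rs {lt_rs sP}; [rewrite leqNgt szr|].
by have := IH s sP s0; lia.
Qed.

Lemma coords_sorted i P : sorted row_below P -> sorted ltn (coords i P).
Proof.
case: P => //= r P; elim: P i r => //= s P IH i r /andP[/row_belowP[le _] sP].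
by rewrite IH // andbT; lia.
Qed.

Lemma last_coords i r P : last 0 (coords i (r :: P)) = (size (last r P) + i + size P).
Proof. by elim: P i r => [|s P IH] i r; [rewrite /= addn0|rewrite [LHS](IH i.+1 s) /= addnS addSn addnS]. Qed.

Lemma coords_bound c n P : is_pattern c n P -> all (ltn^~ (c + n)) (coords 0 P).
Proof.
case: P => // r P /and4P[/eqP szP _ sP le_c].
have := coords_sorted 0 sP; have := last_coords 0 r P.
move: (coords 0 _) => l e sl; have lN : (last 0 l < c + n) by rewrite e; move: szP le_c => /=; lia.
apply/allP => x xl; apply: leq_ltn_trans lN.
move/(sub_sorted (fun x y => @ltnW x y)): sl => sl.
case/splitPr: xl sl => l1 l2; rewrite last_cat /= (sorted_pairwise leq_trans).
rewrite pairwise_cat /= => /and3P[_ _ /andP[/allP H _]].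
by have := mem_last x l2; rewrite in_cons => /predU1P[->//|/H].
Qed.

(** The bottom row of [n + 1] rows with parts at most [n + 1] holds only parts
    1, so that it becomes the empty row after peeling. *)
Lemma mem_patterns c n P : (P \in patterns c n) = is_pattern c n P.
Proof.
elim: n P => [|n IH] P; first by rewrite mem_seq1 /is_pattern; case: P.
apply/allpairsPdep/idP => [[P' [l [+ + ->]]]|].
  rewrite IH => /and4P[/eqP szP rowP sP _] l_in.
  have := @extend_pattern (c + n.+1) n 0 [::] P' l; rewrite /= rowP.
  have -> : path row_below [::] P' by case: P' sP {szP rowP l_in}.
  case=> // [[szB _ _] [rowB sortB lastB]].
  by apply/and4P; split=> //; [rewrite szB szP | move: lastB; rewrite szP; lia].
case: P => [|b B]; first by [].
case/and4P=> /eqP[szB] rowB sortB lastB.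
have b1 : peel b = [::].
  apply/eqP/negPn/negP => pb0.
  have [] := @peel_pattern (size (last b B) + 0 + size B).+1 n 0 b B rowB sortB (leqnn _).
  move=> _ _ rowp sortp.
  have := @row_below_height (peel b) (map peel B) sortp pb0.
  have b0 : (0 < head 0 (peel b)).
    by case/andP: rowp; case: (peel b) pb0 => //= v r _ /andP[_ /andP[/andP[]]].
  rewrite size_map szB.
  have /(allP rowp) : last (peel b) (map peel B) \in map peel (b :: B) by exact: mem_last.
  case: (last _ _) => [|v r] /andP[_ /=]; first by lia.
  by case/andP; lia.
have [] := @peel_pattern (c + n.+1) n 0 b B rowB sortB.
  by rewrite szB; move: lastB => /=; lia.
rewrite /= b1 => cB eB rowp sortp; exists (map peel B), (coords 0 (b :: B)).
split=> //.
rewrite -/(patterns c n) IH; apply/and4P; split=> //.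
- by rewrite size_map szB.
- exact: path_sorted sortp.
case: B lastB sortp {szB rowB sortB cB eB rowp} => //= s B lastB sortp.
rewrite last_map; apply: leq_trans lastB.
by rewrite size_map size_filter count_size.
Qed.

Lemma interlace_uniq N a p : uniq (interlace N a p).
Proof.
elim: p a => [|b p IH] a /=; first by rewrite map_inj_uniq ?iota_uniq // => x y [].
apply: allpairs_uniq_dep => [|t _|]; rewrite ?iota_uniq //.
by move=> [x s] [y u] _ _ [-> ->].
Qed.

Lemma patterns_uniq c n : uniq (patterns c n).
Proof.
elim: n => //= n IH; apply: allpairs_uniq_dep => // [P _|]; first exact: interlace_uniq.
have key P l : P \in patterns c n -> l \in interlace (c + n.+1) 0 (coords 0 P) ->
    map peel (extend 0 ([::] :: P) l) = [::] :: P /\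
    coords 0 (extend 0 ([::] :: P) l) = l.
  rewrite mem_patterns => /and4P[_ rowP sP _] lP.
  have := @extend_pattern (c + n.+1) n 0 [::] P l; rewrite /= rowP.
  have -> : path row_below [::] P by case: P sP {rowP lP}.
  by case=> // [[_ -> ->] _].
move=> _ _ /allpairsPdep[P [l [Pin lin ->]]] /allpairsPdep[P' [l' [Pin' lin' ->]]].
move=> e; have {}e : extend 0 ([::] :: P) l = extend 0 ([::] :: P') l' by exact: e.
have [e1 e2] := key P l Pin lin; have [] := key P' l' Pin' lin'.
by rewrite -e e1 e2 => -[->] ->.
Qed.

End Patterns.

(** * The bialternant formula *)
Section Bialternant.

Variable R : idomainType.
Hypothesis two_neq0 : 2%:R != 0 :> R.

(** The part [v] has weight [x_v], which is stored at position [v - 1]. *)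
Definition weight (xs : seq R) (P : seq (seq nat)) : R :=
  \prod_(v <- flatten P) xs`_v.-1.

(** The head of the list is the most recent variable, whose part is 1; the last
    variable is the weight of the largest part. *)
Fixpoint vandermonde (xs : seq R) : R :=
  if xs is w :: xs' then \prod_(x <- xs') (x - w) * vandermonde xs' else 1.

Lemma weight_extend w xs i P l : size l = size P ->
  all (all (leq 1)) P ->
  weight (w :: xs) (extend i P l) = w ^+ gaps (coords i P) l * weight xs P.
Proof.
rewrite /weight; elim: P i l => [|r P IH] i [|t l] //=; first by rewrite !big_nil mulr1.
case=> szl /andP[r_pos P_pos]; rewrite !big_cat /= IH // big_map /=.
have -> : \prod_(j <- nseq (t - (size r + i)) 1) (w :: xs)`_j.-1 = w ^+ (t - (size r + i)).
  by rewrite big_nseq -Monoid.iteropE.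
have -> : \prod_(j <- r) (w :: xs)`_j = \prod_(j <- r) xs`_j.-1.
  by apply: eq_big_seq => -[|j] // /(allP r_pos).
by rewrite exprD; ring.
Qed.

(** Exchanging two entries of [p] exchanges two vectors of the nested sum. *)
Lemma alternating_nsum N (F : nat -> nat -> R) phi : alternating phi ->
  alternating (fun p => nsum N (map F p) phi).
Proof.
move=> alt s a b u; elim: s phi alt => [|x s IH] phi alt.
  exact: (nsum_swap N (F a) (F b)).
rewrite /= -sumrN; apply: eq_bigr => t _.
by rewrite IH ?mulrN //; apply: alternating_cons.
Qed.

(** The Schur function identity (Vandermonde product times Schur function equals
    alternant), for all shapes at once.  Summing over the last strip turns
    [phi] into a function [psi] of the previous shape that is again alternating,
    to which induction applies. *)
Lemma bialternant c xs phi : alternating phi ->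
  vandermonde xs *
    (\sum_(P <- patterns c (size xs)) weight xs P * phi (coords 0 P)) =
  nsum (c + size xs) (map (@power R) xs) phi.
Proof.
elim: xs phi => [|w xs IH] phi alt.
  by rewrite /= big_seq1 /weight big_nil !mul1r.
rewrite [size _]/= addnS.
pose psi p := nsum (c + size xs).+1 (map (geom w) (0%N :: map succn p)) phi.
have alt_psi : alternating psi.
  move=> s a b u; rewrite /psi !(map_cat succn).
  exact: (alternating_nsum _ (geom w) alt (0%N :: map succn s)).
transitivity (vandermonde (w :: xs) *
    (\sum_(P <- patterns c (size xs)) weight xs P * psi (coords 0 P))).
  congr (_ * _); rewrite patternsS big_allpairs_dep.
  apply: eq_big_seq => P; rewrite mem_patterns => Pp.
  have [/eqP szP rowP sP _] := and4P Pp.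
  rewrite /psi -(sum_interlace two_neq0) //; last 2 first.
  - by have := coords_sorted 0 sP; case: (coords 0 P) => //= x s; rewrite path_map.
  - by apply: sub_all (coords_bound Pp) => x /=; lia.
  rewrite big_distrr; apply: eq_big_seq => l l_in.
  have sP0 : sorted row_below ([::] :: P) by case: P sP {Pp szP rowP l_in}.
  have [] := @extend_pattern _ (size xs) 0 [::] P l rowP sP0 l_in.
  move=> [szB _ cB] _.
  have szl : size l = size ([::] :: P) by rewrite -cB size_coords.
  have P_pos : all (all (leq 1)) ([::] :: P).
    apply/allP => r /(allP (rowP : all (is_row (size xs)) ([::] :: P))).
    by case/andP=> _ /allP H; apply/allP => v /H /andP[].
  rewrite cB weight_extend // [coords 0 _]/= coordsS [RHS]/= mulrCA !mulrA.
  by congr (_ * _ * _).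
rewrite [vandermonde _]/= -mulrA (IH _ alt_psi).
set M := (c + size xs)%N.
pose rho (t : 'I_M.+1) p :=
  nsum M.+1 (map (geom w \o succn) p) (fun s => phi (val t :: s)).
have psiE p : psi p = \sum_(t < M.+1) power w t * rho t p.
  rewrite /psi /=; apply: eq_bigr => t _.
  by rewrite /geom leq0n subn0 /rho map_comp.
rewrite (eq_nsum _ _ psiE) nsum_lin big_distrr.
rewrite [map _ (w :: xs)]/= -(nsum_shear M.+1 two_neq0 (power w)) // -map_comp.
by apply: eq_bigr => t _; rewrite /= mulrCA nsum_geom.
Qed.

End Bialternant.

(** * The sign of the sorting permutation *)
Section Sign.

Variable R : idomainType.
Implicit Types (k a b t : nat) (s u : seq nat) (phi : seq nat -> R).

Definition sg a b : R := (a < b)%:R - (b < a)%:R.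
Definition sgs a s := \prod_(b <- s) sg a b.
(** The sign of the permutation that sorts the list, and 0 if an entry is
    repeated. *)
Fixpoint sort_sign s := if s is a :: s' then sgs a s' * sort_sign s' else 1.

Lemma sgC a b : sg b a = - sg a b.
Proof. by rewrite /sg opprB. Qed.

Lemma sgxx a : sg a a = 0.
Proof. by rewrite /sg ltnn subrr. Qed.

Lemma sg_sqr a b : a != b -> sg a b * sg a b = 1.
Proof. by rewrite /sg; case: ltngtP => // _ _; rewrite ?subr0 ?sub0r ?mulrNN mulr1. Qed.

Lemma sgs_cons a b s : sgs a (b :: s) = sg a b * sgs a s.
Proof. by rewrite /sgs big_cons. Qed.

Lemma sgs0 a s : a \in s -> sgs a s = 0.
Proof. by move=> a_s; rewrite /sgs (big_rem a) //= sgxx mul0r. Qed.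

Lemma alternating_sort_sign : alternating sort_sign.
Proof.
move=> s a b u; elim: s => [|t s IH] /=.
  by rewrite !sgs_cons (sgC b a); ring.
rewrite IH mulrN; congr (- (_ * _)); apply: perm_big.
by apply/permP => p; rewrite !count_cat /= (addnCA (p a)).
Qed.

Lemma sort_sign_sorted s : sorted ltn s -> sort_sign s = 1.
Proof.
elim: s => //= a s IH a_s; rewrite IH ?(path_sorted a_s) // mulr1 /sgs.
rewrite big_seq big1 // => b b_s; have := allP (order_path_min ltn_trans a_s) b b_s.
by rewrite /sg => /= ab; rewrite ab ltnNge ltnW // subr0.
Qed.

Lemma sort_sign_dup s : ~~ uniq s -> sort_sign s = 0.
Proof.
elim: s => //= a s IH; rewrite negb_and negbK.
by case/orP => [/sgs0->|/IH->]; rewrite ?mul0r ?mulr0.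
Qed.

(** The sign of prepending to [s] a value just below [k]: it differs from
    [sgs k s] only when [k] itself occurs in [s].  This half-integer variant
    changes between [k] and [k + 1] only through the entries equal to [k]. *)
Definition side k s : R := \prod_(b <- s) (-1) ^+ (b < k).

Lemma side_cons k b s : side k (b :: s) = (-1) ^+ (b < k) * side k s.
Proof. by rewrite /side big_cons. Qed.

Lemma sideE k s : k \notin s ->
  [/\ side k s = sgs k s, side k.+1 s = sgs k s & sgs k s * sgs k s = 1].
Proof.
elim: s => [|b s IH]; first by rewrite /side /sgs !big_nil mulr1.
rewrite in_cons negb_or eq_sym => /andP[bk /IH[e1 e2 e3]].
rewrite !side_cons sgs_cons e1 e2.
have -> : (-1) ^+ (b < k) = sg k b.
  by rewrite /sg; case: (ltngtP b k) bk => // _ _; rewrite ?subr0 ?sub0r.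
have -> : (-1) ^+ (b < k.+1) = sg k b.
  by rewrite /sg ltnS; case: (ltngtP b k) bk => // _ _; rewrite ?subr0 ?sub0r.
by split=> //; rewrite mulrACA e3 mulr1 sg_sqr // eq_sym.
Qed.

(** If [k] occurs once in [s], the signs on its two sides are opposite and both
    members vanish; if [k] does not occur, the three signs agree. *)
Lemma side_average k s : 2%:R * sort_sign (k :: s) = (side k s + side k.+1 s) * sort_sign s.
Proof.
case: (boolP (uniq s)) => [s_uniq|/sort_sign_dup e]; last by rewrite /= e !mulr0.
have [k_s|/sideE[-> -> _]] := boolP (k \in s); last by rewrite /=; ring.
have := s_uniq; rewrite (perm_uniq (perm_to_rem k_s)) /= => /andP[/sideE[e1 e2 _] _].
rewrite /= sgs0 // /side !(big_rem k k_s) /= -!/(side _ _) e1 e2 ltnn leqnn.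
by rewrite !expr0 expr1; ring.
Qed.

(** Interior product with the basis vector of index [k]: the signed sum over the
    occurrences of [k] in the list, each being removed in turn. *)
Fixpoint contract k phi s : R :=
  if s is b :: s' then
    (b == k)%:R * phi s' - contract k (fun u => phi (b :: u)) s'
  else 0.

Lemma eq_contract k phi psi s : phi =1 psi -> contract k phi s = contract k psi s.
Proof.
elim: s phi psi => //= b s IH phi psi e; rewrite e; congr (_ - _).
by apply: IH => u; apply: e.
Qed.

Lemma contractZ k c phi s : contract k (fun u => c * phi u) s = c * contract k phi s.
Proof. by elim: s phi => [|b s IH] phi /=; rewrite ?mulr0 // IH; ring. Qed.

Lemma contract_sgs k b phi s : b != k ->
  contract k (fun u => sgs b u * phi u) s = sgs b s * sg b k * contract k phi s.
Proof.
move=> bk; elim: s phi => [|t s IH] phi /=; first by rewrite mulr0.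
under eq_contract => u do rewrite sgs_cons -mulrA.
rewrite contractZ IH sgs_cons; case: eqP => [->|_]; last first.
  by rewrite !mul0r; ring.
have := sg_sqr bk; set x := sg b k => x2.
transitivity (sgs b s * phi s - x * x * (sgs b s * contract k (fun u => phi (k :: u)) s)).
  by rewrite mul1r; ring.
transitivity (x * x * (sgs b s * phi s) - x * x * (sgs b s * contract k (fun u => phi (k :: u)) s)).
  by rewrite x2 !mul1r.
by rewrite mul1r; ring.
Qed.

(** Moving an occurrence of [k] to the front costs exactly the sign with which
    it is removed; when [k] is repeated, both sides are 0. *)
Lemma contract_sort_sign k s :
  contract k (fun u => sort_sign (k :: u)) s = (k \in s)%:R * sort_sign s.
Proof.
elim: s => [|b s IH] /=; first by rewrite mul0r.
have -> : contract k (fun u => sort_sign [:: k, b & u]) s =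
          sg k b * contract k (fun u => sgs b u * sort_sign (k :: u)) s.
  by rewrite -contractZ; apply: eq_contract => u /=; rewrite sgs_cons; ring.
rewrite in_cons; have [->|bk] := eqVneq b k; first by rewrite sgxx mul0r subr0 /= !mul1r.
rewrite contract_sgs // IH /= sgC.
have := sg_sqr bk; set x := sg b k => x2.
transitivity (x * x * (sgs b s * ((k \in s)%:R * sort_sign s))); first by ring.
by rewrite x2; ring.
Qed.

(** Crossing [k] reverses the sign of its occurrence, hence the factor 2. *)
Lemma side_diff k s :
  (side k s - side k.+1 s) * sort_sign s = 2%:R * contract k sort_sign s.
Proof.
elim: s => [|b s IH] /=; first by rewrite /side !big_nil; ring.
rewrite !side_cons; have [->|bk] := eqVneq b k.
  rewrite [contract _ _ _]contract_sort_sign ltnn leqnn expr0 expr1.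
  have [/sgs0->|/sideE[-> -> e]] := boolP (k \in s); first by ring.
  transitivity (2%:R * (sgs k s * sgs k s) * sort_sign s); first by ring.
  by rewrite e !mul1r mul0r subr0 mulr1.
rewrite (contract_sgs _ _ bk) mul0r sub0r.
have -> : (-1) ^+ (b < k) = - sg b k.
  by rewrite /sg; case: (ltngtP b k) bk => // _ _; rewrite ?subr0 ?sub0r ?opprK.
have -> : (-1) ^+ (b < k.+1) = - sg b k.
  by rewrite /sg ltnS; case: (ltngtP b k) bk => // _ _; rewrite ?subr0 ?sub0r ?opprK.
transitivity (- (sg b k * sgs b s) * ((side k s - side k.+1 s) * sort_sign s)); first by ring.
by rewrite IH; ring.
Qed.

Variable N : nat.

(** The dependence on [k] is confined to the entries of index [k] of the
    vectors. *)
Lemma nsum_contract k fs phi : (k < N)%N ->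
  nsum N fs (contract k phi) =
  \sum_(i < size fs) (-1) ^+ i * nth (fun=> 0) fs i k *
    nsum N (take i fs ++ drop i.+1 fs) phi.
Proof.
move=> kN; elim: fs phi => [|f fs IH] phi /=; first by rewrite big_ord0.
rewrite big_ord_recl /= drop0 expr0 mul1r.
under eq_bigr => t _ do rewrite nsumD nsumZ nsumN IH mulrDr mulrN.
rewrite big_split /= (bigD1 (Ordinal kN)) //= eqxx mul1r big1 ?addr0; last first.
  by move=> t; rewrite -val_eqE /= => /negbTE->; rewrite mul0r mulr0.
congr (_ + _); under eq_bigr => t _ do rewrite big_distrr -sumrN /=.
rewrite exchange_big; apply: eq_bigr => i _ /=.
rewrite big_distrr; apply: eq_bigr => t _.
by rewrite /bump leq0n add1n add0n exprS /=; ring.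
Qed.

End Sign.

(** * Sequences that are polynomials in a power of q *)
Section Exponential.

Variables (F : fieldType) (q : F).
Hypothesis q_neq0 : q != 0.
Hypothesis q_pow : forall m, (0 < m)%N -> q ^+ m != 1.

Lemma q_sub_neq0 m : q ^+ m.+1 - 1 != 0.
Proof. by rewrite subr_eq0 q_pow. Qed.

Lemma q_power_inj : injective (fun m => q ^+ m).
Proof.
suff lt_neq i j : (i < j)%N -> q ^+ i != q ^+ j.
  move=> i j /= /eqP e; case: (ltngtP i j) => // /lt_neq; last rewrite eq_sym; by rewrite e.
move=> ij; rewrite -(subnK (ltnW ij)) exprD -subr_eq0 -{1}[q ^+ i]mul1r -mulrBl.
by rewrite mulf_eq0 expf_eq0 (negbTE q_neq0) andbF orbF subr_eq0 eq_sym q_pow // subn_gt0.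
Qed.

(** Sequences that are polynomials in [q ^ t] are summable in the same class:
    [z ^ (j+1)] has [q]-difference [(q ^ (j+1) - 1) * z ^ (j+1)], and the factor
    [q ^ t] excludes the constant term, for which this would vanish. *)
Lemma antidifference M (f : nat -> F) (p : {poly F}) :
  (forall t, (t < M)%N -> f t.+1 - f t = q ^+ t * p.[q ^+ t]) ->
  exists2 p' : {poly F}, (size p' <= (size p).+1)%N &
    forall t, (t <= M)%N -> f t = p'.[q ^+ t].
Proof.
move=> fp; pose r := 'X * \poly_(j < size p) (p`_j / (q ^+ j.+1 - 1)).
have rE z : r.[q * z] - r.[z] = z * p.[z].
  rewrite !hornerM !hornerX !horner_poly [p.[z]]horner_coef !big_distrr -sumrB.
  apply: eq_bigr => j _ /=; have := q_sub_neq0 j; rewrite exprMn exprS => qj.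
  by field.
have size_r : (size r <= (size p).+1)%N.
  apply: leq_trans (size_polyMleq _ _) _; rewrite size_polyX /= ltnS; exact: size_poly.
(* The constant term is free: it adjusts the initial value. *)
exists ((f 0%N - r.[1])%:P + r).
  apply: leq_trans (size_polyD _ _) _; rewrite geq_max size_r andbT.
  by apply: leq_trans (size_polyC_leq1 _) _.
elim=> [|t IH] tM; first by rewrite hornerD hornerC subrK.
rewrite -[LHS](subrK (f t)) fp // (IH (ltnW tM)) !hornerD !hornerC exprS.
by rewrite -rE; ring.
Qed.

(** The zeros of the coefficients of [G] on both sides of [0 .. c] are [2m]
    distinct roots of [p], so that [p] is known up to a scalar. *)
Lemma window_roots m c (G p : {poly F}) :
  (size p <= m.*2.+1)%N -> (size G <= c.+1)%N ->
  (forall t, (t < c + m.*2.+1)%N ->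
     q ^+ (m * t) * ('X^m * G)`_t = p.[q ^+ t]) ->
  exists C, forall k, (k <= c)%N ->
    G`_k = C * (\prod_(i < m) (1 - q ^+ (k + 1 + i)) *
                \prod_(i < m) (1 - q ^+ (c - k + 1 + i))).
Proof.
move=> size_p size_G pE.
(* The indices are shifted by [m] with respect to the coefficients of [G]. *)
pose ts := iota 0 m ++ iota (c + m.+1) m.
have ts_uniq : uniq ts.
  rewrite cat_uniq !iota_uniq andbT /=; apply/hasPn => t.
  by rewrite !mem_iota; lia.
have [] := @uniq_roots_prod_XsubC F p [seq q ^+ t | t <- ts].
- apply/allP => _ /mapP[t + ->]; rewrite mem_cat !mem_iota => t_ts.
  rewrite /root -pE; last by lia.
  rewrite coefXnM; case: ltnP => tm; first by rewrite mulr0.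
  by rewrite nth_default ?mulr0 //; apply: leq_trans size_G _; lia.
- by rewrite uniq_rootsE map_inj_uniq //; apply: q_power_inj.
move=> u pu; have size_u : (size u <= 1)%N.
  have [->|u0] := eqVneq u 0; first by rewrite size_poly0.
  move: size_p; rewrite pu size_Mmonic ?monic_prod_XsubC // size_prod_XsubC.
  rewrite size_map size_cat !size_iota. 
  by rewrite addnS addnn -[in X in (_ <= X)%N -> _]add1n leq_add2r.
exists (u`_0 * \prod_(i < m) (- q ^+ (m - i.+1))) => k kc.
have /pE : (k + m < c + m.*2.+1)%N by lia.
rewrite coefXnM ifN ?addnK; last by rewrite -leqNgt leq_addl.
have low : \prod_(t <- iota 0 m) (q ^+ (k + m) - q ^+ t) =
           \prod_(i < m) (- q ^+ (m - i.+1)) * \prod_(i < m) (1 - q ^+ (k + 1 + i)).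
  rewrite -[X in iota 0 X]subn0 -/(index_iota 0 m) big_mkord.
  rewrite (reindex_inj rev_ord_inj) -big_split; apply: eq_bigr => i _ /=.
  have -> : (k + m = (m - i.+1) + (k + 1 + i))%N by have := ltn_ord i; lia.
  by rewrite exprD mulNr mulrBr mulr1 opprB.
have high : \prod_(t <- iota (c + m.+1) m) (q ^+ (k + m) - q ^+ t) =
            q ^+ (m * (k + m)) * \prod_(i < m) (1 - q ^+ (c - k + 1 + i)).
  rewrite -[X in iota _ X](addKn (c + m.+1)) -/(index_iota _ _).
  rewrite -[X in index_iota X _]add0n big_addn addKn big_mkord.
  have -> : q ^+ (m * (k + m)) = \prod_(i < m) q ^+ (k + m).
    by rewrite prodr_const card_ord mulnC exprM.
  rewrite -big_split.
  apply: eq_bigr => i _ /=.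
  have -> : (i + (c + m.+1) = (k + m) + (c - k + 1 + i))%N by lia.
  by rewrite (exprD q (k + m)) mulrBr mulr1.
rewrite {1}pu {1}(size1_polyC size_u) hornerM hornerC horner_prod.
under eq_bigr => x _ do rewrite hornerXsubC.
rewrite big_map big_cat /= low high => e.
apply: (mulfI (expf_neq0 (m * (k + m)) q_neq0)); rewrite e; ring.
Qed.

(** If [H = ('X - y) * H'] with [y = q ^ (s+1)], the coefficients satisfy
    [H_t = H'_(t-1) - y * H'_t]; after multiplication by [q ^ ((s+1) * t)] this
    is a difference equation as in [antidifference].  Each step multiplies by
    ['X] so that the index gained on the left stays a natural number. *)
Lemma strip_factors m M (G p0 : {poly F}) : (size p0 <= m.+1)%N ->
  (forall t, (t < M)%N ->
     ((\prod_(i < m) ('X - (q ^+ i.+1)%:P)) * G)`_t = p0.[q ^+ t]) ->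
  exists2 p : {poly F}, (size p <= m.*2.+1)%N &
    forall t, (t < M + m)%N -> q ^+ (m * t) * ('X^m * G)`_t = p.[q ^+ t].
Proof.
move=> size_p0 p0E.
pose Q s : {poly F} := \prod_(s <= i < m) ('X - (q ^+ i.+1)%:P) * G.
suff chain s : (s <= m)%N -> exists2 p : {poly F}, (size p <= m + s.+1)%N &
    forall t, (t < M + s)%N -> q ^+ (s * t) * ('X^s * Q s)`_t = p.[q ^+ t].
  have [p size_p pE] := chain m (leqnn m).
  exists p; first by rewrite addnS addnn in size_p.
  by move=> t /pE; rewrite /Q big_geq // mul1r.
elim: s => [|s IH] sm.
  exists p0; first by rewrite addn1.
  by move=> t tM; rewrite mul1r expr0 mul1r /Q big_mkord p0E // -[M]addn0.
have [p size_p pE] := IH (ltnW sm).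
have [|p' size_p' p'E] := @antidifference (M + s)
  (fun t => q ^+ (s.+1 * t) * ('X^(s.+1) * Q s.+1)`_t) (- p).
  move=> t tM; rewrite hornerN -pE //.
  have -> : ('X^s * Q s)`_t = ('X^(s.+1) * Q s)`_t.+1.
    by rewrite !coefXnM ltnS subSS.
  have -> : 'X^(s.+1) * Q s = 'X * ('X^(s.+1) * Q s.+1) - (q ^+ s.+1)%:P * ('X^(s.+1) * Q s.+1).
    by rewrite /Q big_ltn //; ring.
  rewrite coefB coefXM coefCM /=.
  have -> : q ^+ (s.+1 * t.+1) = q ^+ t * q ^+ (s * t) * q ^+ s.+1.
    by rewrite -!exprD; congr (_ ^+ _); lia.
  have -> : q ^+ (s.+1 * t) = q ^+ t * q ^+ (s * t) by rewrite -exprD mulSn.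
  by ring.
exists p'; first by apply: leq_trans size_p' _; rewrite size_polyN addnS.
by move=> t; rewrite addnS ltnS; apply: p'E.
Qed.

Lemma coef_of_exponential m c (G p0 : {poly F}) : (size p0 <= m.+1)%N ->
  \prod_(i < m) ('X - (q ^+ i.+1)%:P) * G = \poly_(t < (c + m).+1) p0.[q ^+ t] ->
  (size G <= c.+1)%N /\
  exists C, forall k, (k <= c)%N ->
    G`_k = C * (\prod_(i < m) (1 - q ^+ (k + 1 + i)) *
                \prod_(i < m) (1 - q ^+ (c - k + 1 + i))).
Proof.
move=> size_p0 GE; have size_G : (size G <= c.+1)%N.
  have [->|G0] := eqVneq G 0; first by rewrite size_poly0.
  have := size_poly (c + m).+1 (fun t => p0.[q ^+ t]); rewrite -GE mulrC.
  rewrite size_Mmonic ?monic_prod_XsubC // size_prod_XsubC /index_enum -enumT size_enum_ord.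
  by rewrite addnS /= -addSn leq_add2r.
split=> //; have [|p size_p pE] := @strip_factors m (c + m).+1 G p0 size_p0.
  by move=> t tN; rewrite GE coef_poly tN.
apply: (window_roots size_p size_G) => t tN; apply: pE.
by move: tN; rewrite -addnn; lia.
Qed.

Hypothesis two_neq0 : 2%:R != 0 :> F.

Definition qpowers m : seq F := [seq q ^+ i.+1 | i <- iota 0 m].

(** With vectors of powers of [q ^ (i+1)], the half-integer signs have
    differences that combine the [q ^ ((i+1) * t)]; summing gives a polynomial
    in [q ^ t], and averaging two neighbours gives the sign at [t] itself. *)
Lemma alternant_exponential m N :
  exists2 p : {poly F}, (size p <= m.+1)%N & forall t, (t < N)%N ->
    nsum N (map (@power F) (qpowers m)) (fun s => sort_sign F (t :: s)) =
    p.[q ^+ t].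
Proof.
rewrite /qpowers -map_comp.
set fs := map _ _; have szfs : size fs = m by rewrite size_map size_iota.
pose b t := nsum N fs (fun s => side F t s * sort_sign F s).
pose p0 := \poly_(i < m)
  (- 2%:R * (-1) ^+ i * nsum N (take i fs ++ drop i.+1 fs) (sort_sign F)).
have [|p1 size_p1 bE] := @antidifference N b p0.
  move=> t tN; rewrite /b -opprB.
  have -> : nsum N fs (fun s => side F t s * sort_sign F s) -
            nsum N fs (fun s => side F t.+1 s * sort_sign F s) =
            2%:R * nsum N fs (contract t (sort_sign F)).
    rewrite -nsumN -nsumD -nsumZ; apply: eq_nsum => s.
    by rewrite -side_diff mulrBl.
  rewrite nsum_contract // szfs horner_poly -mulNr !big_distrr /=.
  apply: eq_bigr => i _; rewrite (nth_map 0%N) ?size_iota // nth_iota // add0n.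
  by rewrite /= /power -exprM mulSn exprD mulnC exprM; ring.
exists (\poly_(j < m.+1) (p1`_j * (1 + q ^+ j) / 2%:R)); first exact: size_poly.
move=> t tN.
have : 2%:R * nsum N fs (fun s => sort_sign F (t :: s)) = b t + b t.+1.
  rewrite /b -nsumD -nsumZ; apply: eq_nsum => s.
  by rewrite side_average mulrDl.
rewrite !bE //; last exact: ltnW.
have sz1 : (size p1 <= m.+1)%N.
  by apply: leq_trans size_p1 _; rewrite ltnS size_poly.
rewrite !(horner_coef_wide _ sz1) -big_split horner_poly => e.
apply: (mulfI two_neq0); rewrite e big_distrr.
apply: eq_bigr => j _ /=; rewrite exprS exprMn; by field.
Qed.

End Exponential.

(** * The generating polynomial by number of largest parts *)
Section Refined.

Variables (F : fieldType) (q : F).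
Hypothesis q_neq0 : q != 0.
Hypothesis q_pow : forall m, (0 < m)%N -> q ^+ m != 1.
Hypothesis two_neq0 : 2%:R != 0 :> F.

Lemma sort_sign_polyC s : sort_sign {poly F} s = (sort_sign F s)%:P.
Proof.
elim: s => [|a s IH] /=; first by rewrite polyC1.
rewrite IH polyCM; congr (_ * _); rewrite /sgs rmorph_prod.
by apply: eq_bigr => b _; rewrite /sg rmorphB !rmorph_nat.
Qed.

Lemma nsum_polyC N (ys : seq F) (phi : seq nat -> F) :
  nsum N (map (@power {poly F}) (map polyC ys)) (fun s => (phi s)%:P) =
  (nsum N (map (@power F) ys) phi)%:P.
Proof.
elim: ys phi => //= y ys IH phi; rewrite rmorph_sum.
by apply: eq_bigr => t _; rewrite IH /power rmorphM rmorphXn.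
Qed.

Lemma vandermonde_rcons (R : idomainType) (ys : seq R) x :
  vandermonde (rcons ys x) = vandermonde ys * \prod_(y <- ys) (x - y).
Proof.
elim: ys => [|y ys IH] /=; first by rewrite !big_nil.
by rewrite IH big_rcons big_cons /=; ring.
Qed.

Lemma vandermonde_polyC (ys : seq F) :
  vandermonde (map polyC ys) = (vandermonde ys)%:P.
Proof.
elim: ys => [|y ys IH] /=; first by rewrite polyC1.
rewrite IH big_map rmorphM rmorph_prod; congr (_ * _).
by apply: eq_bigr => x _; rewrite rmorphB.
Qed.

Lemma vandermonde_neq0 (ys : seq F) : uniq ys -> vandermonde ys != 0.
Proof.
elim: ys => [|y ys IH] /=; first by rewrite oner_eq0.
case/andP=> y_ys /IH V0; rewrite mulf_neq0 //.
rewrite prodf_seq_neq0; apply/allP => x x_ys /=.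
by rewrite subr_eq0; apply: contraNneq y_ys => <-.
Qed.

Definition refined_poly m c : {poly F} :=
  \sum_(P <- patterns c m.+1) weight (rcons (map polyC (qpowers q m)) 'X) P.

(** The indeterminate is the weight of the largest part, hence the last
    variable.  Moving it to the front costs the sign [(-1) ^ m] and exhibits the
    coefficients of its powers. *)
Lemma refined_poly_factored m c :
  (vandermonde (qpowers q m))%:P *
    (\prod_(i < m) ('X - (q ^+ i.+1)%:P) * refined_poly m c) =
  \poly_(t < (c + m).+1)
    ((-1) ^+ m * nsum (c + m).+1 (map (@power F) (qpowers q m))
                   (fun s => sort_sign F (t :: s))).
Proof.
set xs := rcons (map polyC (qpowers q m)) 'X.
have size_xs : size xs = m.+1 by rewrite size_rcons !size_map size_iota.
have two_neq0P : 2%:R != 0 :> {poly F} by rewrite -polyC_natr polyC_eq0.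
have := bialternant two_neq0P c xs (@alternating_sort_sign _).
rewrite size_xs vandermonde_rcons vandermonde_polyC addnS.
have -> : \prod_(y <- map polyC (qpowers q m)) ('X - y) =
          \prod_(i < m) ('X - (q ^+ i.+1)%:P).
  by rewrite !big_map -(big_mkord xpredT (fun i => 'X - (q ^+ i.+1)%:P)) /index_iota subn0.
have -> : \sum_(P <- patterns c m.+1) weight xs P * sort_sign {poly F} (coords 0 P) =
          refined_poly m c.
  apply: eq_big_seq => P; rewrite mem_patterns => /and4P[_ _ sP _].
  by rewrite sort_sign_sorted ?mulr1 // coords_sorted.
rewrite -mulrA => ->; rewrite /xs map_rcons nsum_rcons; last exact: alternating_sort_sign.
rewrite !size_map size_iota poly_def /= big_distrr; apply: eq_bigr => t _ /=.
rewrite (eq_nsum _ _ (fun s => sort_sign_polyC (val t :: s))) nsum_polyC.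
by rewrite -mul_polyC rmorphM rmorph_sign [RHS]mulrC mulrCA.
Qed.

Lemma qrisingE a m :
  qrising q a m = (\prod_(i < m) (1 - q ^+ (a + i))) / (1 - q) ^+ m.
Proof.
rewrite /qrising big_mkord /qint big_split /= prodfV prodr_const card_ord.
by [].
Qed.

Lemma refined_poly_coef m c :
  (size (refined_poly m c) <= c.+1)%N /\
  exists C, forall k, (k <= c)%N ->
    (refined_poly m c)`_k = C * (qrising q (k + 1) m * qrising q (c - k + 1) m).
Proof.
have q1 : 1 - q != 0 by rewrite subr_eq0 eq_sym -[q]expr1 q_pow.
have [p size_p pE] := @alternant_exponential F q q_pow two_neq0 m (c + m).+1.
have V0 : vandermonde (qpowers q m) != 0.
  by apply: vandermonde_neq0; rewrite map_inj_uniq ?iota_uniq // => i j /(q_power_inj q_neq0 q_pow) [].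
pose p0 := ((-1) ^+ m / vandermonde (qpowers q m)) *: p.
have [||size_G [C CE]] := @coef_of_exponential F q q_neq0 q_pow m c (refined_poly m c) p0.
- by apply: leq_trans size_p; apply: size_scale_leq.
- have VP : (vandermonde (qpowers q m))%:P != 0 by rewrite polyC_eq0.
  apply: (mulfI VP); rewrite refined_poly_factored; apply/polyP => t.
  rewrite coefCM !coef_poly; case: ifP => tN; last by rewrite mulr0.
  by rewrite pE // hornerZ mulrA mulrC [vandermonde _ * _]mulrC divfK // mulrC.
split=> //; exists (C * (1 - q) ^+ m * (1 - q) ^+ m) => k kc.
rewrite CE // !qrisingE.
have := expf_neq0 m q1; set u := (1 - q) ^+ m => u0.
by field.
Qed.

End Refined.

(** * Strict plane partitions as padded arrays *)
Section StrictPlanePartitions.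
Local Open Scope nat_scope.

Lemma column_cons r (pi : array) j :
  column (r :: pi) j = if j < size r then nth 0 r j :: column pi j else column pi j.
Proof. by rewrite /column /=; case: ifP. Qed.

Lemma column_nil (s : seq nat) (pi : array) j :
  path geq (size s) (shape pi) -> size s <= j -> column pi j = [::].
Proof.
rewrite (path_sortedE (rev_trans leq_trans)) => /andP[/allP H _] sj.
rewrite /column (@eq_in_filter _ _ pred0) ?filter_pred0 // => r r_pi.
by apply/negbTE; rewrite -leqNgt; apply: leq_trans sj; apply/H/map_f.
Qed.

(** As the row lengths decrease, a column is an initial segment of the rows, and
    its strictness can be tested on consecutive rows. *)
Lemma columns_rows (pi : array) :
  sorted geq (shape pi) &&
    all (fun j => sorted gtn (column pi j)) (iota 0 (ncolumns pi)) =
  sorted (fun r s => row_below s r) pi.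
Proof.
elim: pi => // r [_|s pi IH].
  by apply/allP => j _; rewrite column_cons /column; case: ifP.
have -> : sorted (fun r s => row_below s r) [:: r, s & pi] =
          row_below s r && sorted (fun r s => row_below s r) (s :: pi) by [].
have -> : sorted geq (shape [:: r, s & pi]) =
          (size s <= size r) && sorted geq (shape (s :: pi)) by [].
rewrite -IH /row_below -!andbA; case: (boolP (size s <= size r)) => //= sr.
rewrite [RHS]andbCA; case: (boolP (path geq _ _)) => //= s_pi.
have colE j : j < size r -> sorted gtn (column [:: r, s & pi] j) =
    (j < size s) ==> (nth 0 s j < nth 0 r j) && sorted gtn (column (s :: pi) j).
  move=> jr; rewrite column_cons jr column_cons; case: ltnP => //= sj.
  by rewrite (column_nil s_pi sj).
apply/allP/andP => [H|[/allP H1 /allP H2] j]; last first.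
  rewrite mem_iota => jr; rewrite colE //; apply/implyP => js.
  by rewrite H1 ?H2 ?mem_iota.
have H' j : j < size s -> (nth 0 s j < nth 0 r j) && sorted gtn (column (s :: pi) j).
  move=> js; have jr := leq_trans js sr.
  by have := H j; rewrite mem_iota colE // js; apply.
by split; apply/allP => j; rewrite mem_iota => /H' /andP[].
Qed.

Definition strip (P : array) : array := rev [seq r <- P | r != [::]].
Definition pad n (pi : array) : array := nseq (n - size pi) [::] ++ rev pi.

Lemma strip_pad n (pi : array) : [::] \notin pi -> strip (pad n pi) = pi.
Proof.
move=> pi0; rewrite /strip /pad filter_cat filter_rev.
have -> : [seq r <- nseq (n - size pi) [::] | r != [::]] = [::] :> array.
  by elim: (n - size pi).
rewrite cat0s revK; apply/all_filterP/allP => r r_pi.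
by apply: contraNneq pi0 => <-.
Qed.

Lemma pad_strip (P : array) : sorted row_below P -> pad (size P) (strip P) = P.
Proof.
rewrite /pad /strip revK size_rev; elim: P => //= r P IH rP.
have le : size [seq r <- P | r != [::]] <= size P by rewrite size_filter count_size.
case: eqVneq => [r0|r0] /=.
  by rewrite r0 subSn //= IH // (path_sorted rP).
have P0 : [seq r <- P | r != [::]] = P.
  apply/all_filterP; elim: P r r0 rP {IH le} => //= s P IH r r0 /andP[/row_belowP[le _] sP].
  by have s0 : s != [::]; [case: s le {sP} => //; case: r r0 | rewrite s0 (IH s)].
by rewrite P0 subnn.
Qed.

Lemma nil_strip (P : array) : [::] \notin strip P.
Proof. by rewrite mem_rev mem_filter eqxx. Qed.

Lemma perm_strip (P : array) : perm_eq (flatten (strip P)) (flatten P).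
Proof.
apply: (@perm_trans _ (flatten [seq r <- P | r != [::]])).
  by apply: perm_flatten; rewrite perm_rev.
by elim: P => // -[|x r] P IH //=; rewrite -cat_cons perm_cat2l.
Qed.

Lemma is_spp_pad n c k (pi : array) : size pi <= n -> [::] \notin pi ->
  is_spp n c k pi =
  is_pattern c n (pad n pi) && (count_mem n (flatten (pad n pi)) == k).
Proof.
move=> pi_n pi0.
have -> : count_mem n (flatten (pad n pi)) = count_mem n (flatten pi).
  by rewrite -{2}(strip_pad n pi0); apply/esym/permP/perm_strip.
rewrite /is_spp /is_pattern /strict_plane_partition /is_partition.
have -> : 0 \notin shape pi.
  by apply: contra pi0 => /mapP[r r_pi /esym/size0nil <-].
rewrite andbT size_cat size_nseq size_rev subnK // eqxx /=.
have -> : all (is_row n) (pad n pi) =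
          all (sorted geq) pi && all (fun x => 1 <= x <= n) (flatten pi).
  rewrite all_cat all_nseq orbT /= all_rev.
  by elim: (pi) => //= r p ->; rewrite all_cat /is_row -!andbA; do !bool_congr.
have -> : sorted row_below (pad n pi) = sorted (fun r s => row_below s r) pi.
  rewrite /pad -[in RHS](revK pi) rev_sorted; elim: (n - size pi) => //= j <-.
  by case: (nseq j _ ++ rev pi).
have -> : size (last [::] (pad n pi)) = ncolumns pi.
  rewrite /pad last_cat /ncolumns; case: (pi) => [|r p] /=.
    by elim: (n - 0).
  by rewrite rev_cons last_rcons.
by rewrite -columns_rows -!andbA; do !bool_congr.
Qed.

Lemma spp_patterns (R : pzSemiRingType) (q : R) n c k :
  (\sum_(pi : spp n c k) q ^+ norm pi =
   \sum_(P <- patterns c n | count_mem n (flatten P) == k) q ^+ sumn (flatten P))%R.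
Proof.
pose Ps := [seq P <- patterns c n | count_mem n (flatten P) == k].
have Ps_pattern P : P \in Ps -> is_pattern c n P.
  by rewrite mem_filter mem_patterns => /andP[].
have padK P : P \in Ps -> pad n (strip P) = P.
  by move=> /Ps_pattern/and4P[/eqP<- _ sP _]; apply: pad_strip.
have Ps_spp : perm_eq [seq val pi | pi <- enum {: spp n c k}] (map strip Ps).
  apply: uniq_perm => [||pi].
  - by rewrite map_inj_uniq ?enum_uniq //; apply: val_inj.
  - rewrite map_inj_in_uniq ?filter_uniq ?patterns_uniq // => P P' PP PP' e.
    by rewrite -(padK P PP) e padK.
  apply/mapP/mapP => [[x _ ->]|[P PP ->]].
    have := valP x; move: (val x) => y y_spp {x pi}.
    have y0 : [::] \notin y.
      have /and4P[/and3P[/andP[_ +] _ _] _ _ _] := y_spp.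
      by apply: contra => y0; apply/mapP; exists [::].
    exists (pad n y); last by rewrite strip_pad.
    rewrite mem_filter mem_patterns andbC -is_spp_pad //.
    exact: is_spp_size y_spp.
  have P_spp : is_spp n c k (strip P).
    rewrite is_spp_pad ?nil_strip ?padK //.
      by rewrite (Ps_pattern P PP); move: PP; rewrite mem_filter => /andP[].
    have /and4P[/eqP<- _ _ _] := Ps_pattern P PP.
    by rewrite size_rev size_filter count_size.
  by exists (Spp P_spp); rewrite ?mem_enum.
rewrite -big_enum /= -(big_map val xpredT (fun pi => q ^+ norm pi)%R).
rewrite (perm_big _ Ps_spp) big_map big_filter.
by apply: eq_bigr => P _; rewrite /norm (perm_sumn (perm_strip P)).
Qed.

End StrictPlanePartitions.

(** * The constant factor *)
Section Evaluation.

Variables (F : fieldType) (q : F).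
Hypothesis q_neq0 : q != 0.
Hypothesis q_pow : forall m, (0 < m)%N -> q ^+ m != 1.

Lemma qint_neq0 m : qint q m.+1 != 0.
Proof.
by rewrite mulf_neq0 ?invr_eq0 ?subr_eq0 1?eq_sym ?q_pow // -[q]expr1 q_pow.
Qed.

Lemma qrising_neq0 a m : qrising q a.+1 m != 0.
Proof.
rewrite /qrising big_mkord; apply/prodf_neq0 => i _.
by rewrite addSn qint_neq0.
Qed.

Lemma qrisingD a m p : qrising q a (m + p) = qrising q a m * qrising q (a + m) p.
Proof.
rewrite /qrising (big_cat_nat (n := m)) ?leq_addr //=; congr (_ * _).
rewrite -{1}[m]add0n big_addn addKn.
by apply: eq_bigr => i _; rewrite -addnA [(i + m)%N]addnC.
Qed.

Lemma qrising0 a : qrising q a 0 = 1.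
Proof. by rewrite /qrising big_geq. Qed.

Lemma qrising_recr a m : qrising q a m.+1 = qrising q a m * qint q (a + m).
Proof. by rewrite /qrising big_nat_recr. Qed.

Lemma qrising_recl a m : qrising q a m.+1 = qint q a * qrising q a.+1 m.
Proof.
rewrite /qrising big_nat_recl // addn0; congr (_ * _).
by apply: eq_bigr => i _; rewrite addSnnS.
Qed.

(** The Gaussian binomial coefficient [c + m] choose [m]. *)
Definition qbinom m c := qrising q c.+1 m / qrising q 1 m.

Lemma qbinom0 c : qbinom 0 c = 1.
Proof. by rewrite /qbinom !qrising0 divr1. Qed.

Lemma qbinom_0 m : qbinom m 0 = 1.
Proof. by rewrite /qbinom divff // qrising_neq0. Qed.

Lemma qbinom_pascal m c :
  qbinom m.+1 c.+1 = qbinom m c.+1 + q ^+ m.+1 * qbinom m.+1 c.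
Proof.
rewrite /qbinom (qrising_recl c.+1) (qrising_recr c.+2) (qrising_recr 1).
have := qrising_neq0 c.+1 m; have := qrising_neq0 0 m.
have := qint_neq0 m; set u := qrising q 1 m; set v := qrising q c.+2 m.
rewrite /qint add1n => m0 u0 v0.
have q1 : 1 - q != 0 by rewrite subr_eq0 eq_sym -[q]expr1 q_pow.
have m1 : 1 - q ^+ m.+1 != 0 by rewrite subr_eq0 eq_sym q_pow.
have -> : q ^+ (c.+2 + m) = q ^+ m.+1 * q ^+ c.+1.
  by rewrite -exprD; congr (_ ^+ _); lia.
move: (q ^+ m.+1) (q ^+ c.+1) m1 {m0} => x y x1.
by field; rewrite x1 u0 q1.
Qed.

(** The q-Vandermonde identity obtained by comparing coefficients of [z ^ c] in
    1/(z; q)_(a+b+2) = 1/(z; q)_(b+1) * 1/(q ^ (b+1) z; q)_(a+1); the Pascal rule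
    gives it by induction on [a] and [c]. *)
Lemma qbinom_convolution a b c :
  \sum_(k < c.+1) q ^+ (k * b.+1) * qbinom a k * qbinom b (c - k) =
  qbinom (a + b).+1 c.
Proof.
elim: a c => [|a IHa] c.
  elim: c => [|c IHc]; first by rewrite big_ord1 !qbinom_0 !mulr1.
  rewrite big_ord_recl qbinom_pascal -IHc big_distrr /= mul0n !qbinom0 mul1r mul1r subn0.
  congr (_ + _); apply: eq_bigr => k _ /=.
  by rewrite !qbinom0 /bump leq0n add1n subSS mulSn exprD; ring.
elim: c => [|c IHc]; first by rewrite big_ord1 !qbinom_0 !mulr1.
rewrite addSn qbinom_pascal -IHc -IHa big_ord_recl [X in _ = X + _]big_ord_recl.
rewrite !qbinom_0 -addrA; congr (_ + _).
rewrite big_distrr -big_split; apply: eq_bigr => k _ /=.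
rewrite /bump leq0n add1n subSS qbinom_pascal.
have -> : q ^+ (k.+1 * b.+1) = q ^+ b.+1 * q ^+ (k * b.+1) by rewrite -exprD mulSn.
have -> : q ^+ (a + b).+2 = q ^+ a.+1 * q ^+ b.+1 by rewrite -exprD addSn addnS.
by ring.
Qed.

Lemma weight_specialized m (s : seq nat) :
  all (fun v => 0 < v <= m.+1)%N s ->
  exists2 r, (r + m.+1 * count_mem m.+1 s = sumn s)%N &
    \prod_(v <- s) (rcons (map polyC (qpowers q m)) 'X)`_v.-1 =
    (q ^+ r)%:P * 'X^(count_mem m.+1 s).
Proof.
elim: s => [|v s IH]; first by exists 0%N; rewrite ?muln0 // big_nil mul1r.
case/andP=> /andP[v0 vm] /IH[r r_s rE]; rewrite big_cons rE /=.
have szq : size (map polyC (qpowers q m)) = m by rewrite !size_map size_iota.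
rewrite nth_rcons szq; case: (eqVneq v m.+1) => [->|vm'].
  exists r; first by rewrite mulnDr muln1 addnCA r_s.
  by rewrite ltnn eqxx exprD expr1 mulrCA.
have vm1 : (v.-1 < m)%N by lia.
exists (v + r)%N; first by rewrite add0n -r_s addnA.
rewrite vm1 (nth_map 0) ?size_map ?size_iota // (nth_map 0%N) ?size_iota //.
by rewrite nth_iota // add0n prednK // exprD rmorphM mulrA.
Qed.

Definition pattern_gf n c : F :=
  \sum_(P <- patterns c n) q ^+ sumn (flatten P).
Definition refined_pattern_gf n c k : F :=
  \sum_(P <- patterns c n | count_mem n (flatten P) == k) q ^+ sumn (flatten P).

Lemma pattern_bounds c n P : P \in patterns c n ->
  all (fun v => 0 < v <= n)%N (flatten P).
Proof.
rewrite mem_patterns => /and4P[_ /allP P_row _ _].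
by apply/allP => v /flattenP[r /P_row/andP[_ /allP H] /H].
Qed.

Lemma refined_pattern_gfE m c k :
  refined_pattern_gf m.+1 c k = q ^+ (k * m.+1) * (refined_poly q m c)`_k.
Proof.
rewrite /refined_pattern_gf /refined_poly coef_sum big_distrr big_mkcond /=.
apply: eq_big_seq => P P_in; have P_bnd := pattern_bounds (P_in : P \in patterns c m.+1).
have [r r_s rE] := weight_specialized P_bnd.
rewrite /weight rE coefCM coefXn eq_sym; case: eqP => [->|_]; last by rewrite !mulr0.
by rewrite mulr1 -exprD -r_s addnC mulnC.
Qed.

Lemma pattern_gf_horner m c : pattern_gf m.+1 c = (refined_poly q m c).[q ^+ m.+1].
Proof.
rewrite /pattern_gf /refined_poly horner_sum.
apply: eq_big_seq => P P_in; have P_bnd := pattern_bounds (P_in : P \in patterns c m.+1).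
have [r r_s rE] := weight_specialized P_bnd.
by rewrite /weight rE hornerM hornerC hornerXn -exprM -exprD r_s.
Qed.

(** Without a part [n + 1] the bottom one of the [n + 1] rows is empty, because
    column entries increase strictly from bottom to top. *)
Lemma refined_pattern_gf0 n c : refined_pattern_gf n.+1 c 0 = pattern_gf n c.
Proof.
rewrite /refined_pattern_gf /pattern_gf -big_filter.
rewrite (perm_big [seq [::] :: P | P <- patterns c n]); first by rewrite big_map.
apply: uniq_perm => [||B].
- by rewrite filter_uniq // patterns_uniq.
- by rewrite map_inj_uniq ?patterns_uniq // => P P' [].
rewrite mem_filter mem_patterns; apply/andP/mapP => [[nB]|[P PP ->]].
  case: B nB => // r B nB /and4P[/eqP[szB] rowB sB lastB].
  have {}rowB : all (is_row n) (r :: B).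
    apply/allP => s s_in; have /andP[s_dec /allP s_bnd] := allP rowB s s_in.
    apply/andP; split=> //; apply/allP => v v_s; have := s_bnd v v_s.
    have : v != n.+1; last by lia.
    apply: contraTneq nB => v_n; rewrite -lt0n -has_count; apply/hasP; exists v; last exact/eqP.
    by apply/flattenP; exists s.
  have r0 : r = [::].
    apply/eqP/negPn/negP => r0; have := row_below_height sB r0.
    have : is_row n (last r B) by apply: (allP rowB); apply: mem_last.
    have : (0 < head 0%N r)%N.
      by case/andP: rowB => /andP[_]; case: (r) r0 => //= v r' _ /andP[/andP[]].
    case: (last r B) => [|v s]; first by rewrite /=; lia.
    by move=> + /andP[_ /= /andP[/andP[_ vn] _]]; rewrite szB; lia.
  exists B; last by rewrite r0.
  rewrite mem_patterns; apply/and4P; split.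
  - by rewrite szB.
  - by case/andP: rowB.
  - exact: path_sorted sB.
  - by move: lastB; case: (B).
move: PP; rewrite mem_patterns => PP; have /and4P[/eqP szP rowP sP lastP] := PP.
split.
  rewrite /= -leqn0 leqNgt -has_count; apply/hasPn => v.
  have := pattern_bounds (c := c) (n := n) (P := P); rewrite mem_patterns => /(_ PP)/allP H /H /andP[_ vn].
  by rewrite /= neq_ltn ltnS vn.
apply/and4P; split.
- by rewrite /= szP.
- rewrite /=; apply: sub_all rowP => s /andP[s_dec s_bnd]; rewrite /is_row s_dec.
  by apply: sub_all s_bnd => v; lia.
- by case: (P) sP.
- by case: (P) lastP.
Qed.

(** The part of the closed formula that does not depend on [k]. *)
Definition prefactor m c : F :=
  \prod_(1 <= i < m.+1) (qrising q (c + i + 1) (i - 1) / qrising q i i) /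
  qrising q 1 m.

Lemma prefactorS m c :
  prefactor m.+1 c * (qrising q 1 m.+1 * qrising q c.+1 m.+1) =
  prefactor m c * (qrising q 1 m) ^+ 2 * qbinom (m + m).+1 c.
Proof.
rewrite /prefactor big_nat_recr //= /qbinom.
have -> : qrising q c.+1 (m + m).+1 =
          qrising q c.+1 m.+1 * qrising q (c.+1 + m.+1) m by rewrite -qrisingD addSn.
have -> : qrising q 1 (m + m).+1 = qrising q 1 m * qrising q m.+1 m.+1.
  by rewrite -addnS qrisingD add1n.
have -> : (c + m.+1 + 1 = c.+1 + m.+1)%N by lia.
rewrite subn1 /=; have := qrising_neq0 0 m; have := qrising_neq0 0 m.+1.
have := qrising_neq0 m m.+1 => h1 h2 h3.
by field; rewrite h1 h2 h3.
Qed.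

Hypothesis two_neq0 : 2%:R != 0 :> F.

(** The arrays in which the largest part does not occur fix the constant: their
    sum is the total for one part value less, which induction and the q-Vandermonde
    identity evaluate. *)
Lemma refined_poly_closed m c k : (k <= c)%N ->
  (refined_poly q m c)`_k =
  prefactor m c * (qrising q (k + 1) m * qrising q (c - k + 1) m).
Proof.
have [size_G [C CE]] := refined_poly_coef q_neq0 q_pow two_neq0 m c.
suff -> : prefactor m c = C by exact: CE.
elim: m C size_G CE {k} => [|m IH] C size_G CE.
  have := refined_pattern_gfE 0 c 0; rewrite refined_pattern_gf0 mul0n mul1r CE // !qrising0.
  rewrite /pattern_gf /= big_seq1 /= !mulr1 => <-.
  by rewrite /prefactor big_geq // qrising0 divr1.
have r0 : qrising q 1 m.+1 * qrising q c.+1 m.+1 != 0.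
  by rewrite mulf_neq0 ?qrising_neq0.
apply: (mulIf r0); rewrite prefactorS.
have := refined_pattern_gfE m.+1 c 0; rewrite refined_pattern_gf0 mul0n mul1r CE // subn0 add0n addn1.
move=> <-; have [size_Gm [Cm CmE]] := refined_poly_coef q_neq0 q_pow two_neq0 m c.
rewrite pattern_gf_horner (horner_coef_wide _ size_Gm) (IH Cm) // -qbinom_convolution.
rewrite big_distrr; apply: eq_bigr => k _ /=.
rewrite CmE; last by rewrite -ltnS ltn_ord.
rewrite -exprM [(m.+1 * k)%N]mulnC /qbinom !addn1.
by have := qrising_neq0 0 m => h; field.
Qed.

Lemma refined_pattern_gf_closed n c k : (0 < n)%N -> (k <= c)%N ->
  refined_pattern_gf n c k =
  q ^+ (k * n) * qrising q (k + 1) (n - 1) * qrising q (1 + c - k) (n - 1)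
    / qrising q 1 (n - 1)
  * \prod_(1 <= i < n) (qrising q (c + i + 1) (i - 1) / qrising q i i).
Proof.
case: n => // m _ kc; rewrite refined_pattern_gfE refined_poly_closed // /prefactor subn1 /=.
have -> : (1 + c - k = c - k + 1)%N by lia.
by ring.
Qed.

End Evaluation.

Lemma qvar_neq0 : qvar != 0.
Proof. by rewrite tofrac_eq0 polyX_eq0. Qed.

Lemma qvar_pow m : (0 < m)%N -> qvar ^+ m != 1.
Proof.
move=> m0; rewrite -tofracXn -tofrac1 tofrac_eq.
apply/eqP => /(congr1 (fun p : {poly rat} => size p)).
by rewrite size_polyXn size_poly1; lia.
Qed.

Lemma ratfun_two_neq0 : 2%:R != 0 :> ratfun.
Proof. by rewrite -(rmorph_nat (@tofrac {poly rat})) tofrac_eq0 -polyC_natr polyC_eq0. Qed.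

Theorem theorem1 (n c k : nat) (n_ge1 : (1 <= n)%N) (k_le_c : (k <= c)%N) :
  let q := qvar in
  \sum_(pi : spp n c k) q ^+ norm pi =
    q ^+ (k * n) * qrising q (k + 1) (n - 1) * qrising q (1 + c - k) (n - 1)
      / qrising q 1 (n - 1)
    * \prod_(1 <= i < n) (qrising q (c + i + 1) (i - 1) / qrising q i i).
Proof.
move=> q; rewrite spp_patterns; apply: refined_pattern_gf_closed => //.
- exact: qvar_neq0.
- exact: qvar_pow.
- exact: ratfun_two_neq0.
Qed.
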